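(* Define, for all $m \geq 2$, $\varepsilon, b, d > 0$, $K : (0,\infty) \to (0, \infty)$ and $\{\alpha_i\}_{i=1}^m \subseteq (0,1)$, $$\Sigma_{m,\{\alpha_i\}_{i=1}^m,K,b,d}(\varepsilon):=\varphi\big(\varepsilon,b,d,\ \delta\mapsto \Psi(m,\{\alpha_i\}_{i=1}^m,K,\delta),\ \omega_{\alpha_1\star\cdots\star\alpha_m}\big),$$ where $\varphi$, $\Psi$, $\omega_\bullet$ and $\star$ are the explicit functions given in the context. Let $X$ be a Hilbert space. Let $m \geq 2$, $\alpha_1,\ldots,\alpha_m \in (0,1)$ and $R_1,\ldots,R_m:X \to X$ be such that for each $i$, $R_i$ is $\alpha_i$-averaged. Put $R:=R_m \circ\cdots\circ R_1$. Let $K: (0,\infty) \to (0,\infty)$ be such that for all $i \in \{1,\ldots,m\}$ and all $\varepsilon > 0$ there is a $p \in X$ with $\|p\| \leq K(\varepsilon)$ and $\|p-R_ip\| \leq \varepsilon$. Then for any $b, d>0$ and any $x \in X$ with $\|x\| \leq b$ and $\|x-Rx\|\leq d$, the function $\Sigma_{m,\{\alpha_i\}_{i=1}^m,K,b,d}$ is a rate of asymptotic regularity for the sequence $(R^nx)_n$ with respect to $R$, i.e. for any $\varepsilon>0$ and any $n \in \mathbb{N}$ with $n \geq \Sigma_{m,\{\alpha_i\}_{i=1}^m,K,b,d}(\varepsilon)$, $$\|R^nx-R^{n+1}x\|\leq \varepsilon.$$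
   Context: Averaged mappings. Let $X$ be a Hilbert space. A mapping $T: X \to X$ is nonexpansive if $\|Tx-Ty\| \leq \|x-y\|$ for all $x,y \in X$. For $\alpha \in (0,1)$, a mapping $R:X \to X$ is $\alpha$-averaged if there is a nonexpansive $T:X \to X$ such that $Rx = (1-\alpha)x+\alpha Tx$ for all $x \in X$. The operation $\star$. For $\alpha,\beta \in (0,1)$, $$\alpha\star\beta := \frac{\alpha+\beta-2\alpha\beta}{1-\alpha\beta} = \frac1{1+\frac1{\frac\alpha{1-\alpha} + \frac\beta{1-\beta}}}.$$ This operation is associative and commutative, and for $m \ge 2$, $\alpha_1 \star\cdots \star\alpha_m = \Big(1+\big(\sum_{i=1}^m \frac{\alpha_i}{1-\alpha_i}\big)^{-1}\Big)^{-1}$. The function $\Theta$. For $\beta, L_1, L_2, L_3 > 0$, $$\Theta(\beta,L_1,L_2,L_3):=(L_1+L_2) \left(L_3 + \frac{L_1+L_2+2\beta L_3 + \sqrt{L_1^2 + L_2^2 + 2L_1L_2 + 8\beta L_1L_3 + 4\beta L_2L_3}}{2\beta}\right).$$ The functions $B$ and $\Phi$. For $\alpha_1,\alpha_2 \in (0,1)$, $\delta > 0$ and $K : (0,\infty) \to (0, \infty)$, $$B(\alpha_2,K,\delta):=\sqrt{\left(K\left(\tfrac\delta4\right)+\tfrac\delta8\right)^2 + 2\,\Theta\left(\alpha_2^{-1}-1,\ K\left(\tfrac\delta4\right)+\tfrac\delta8,\ K\left(\tfrac\delta4\right)+\tfrac\delta8,\ \tfrac\delta8\right)},$$ $$\Phi(\alpha_1,\alpha_2,K,\delta):=B(\alpha_2,K,\delta)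 \cdot \max\left(\sqrt{2}, \frac{4B(\alpha_2,K,\delta)}\delta \right) \cdot \frac1{1-\alpha_1} + \frac{\alpha_1}{1-\alpha_1} \left(K\left(\tfrac\delta4\right)+\tfrac\delta8\right) + \frac\delta8.$$ The function $\Psi$ is defined by recursion on $m \geq 2$, for $\delta>0$, $K : (0,\infty) \to (0, \infty)$ and $\alpha_i \in (0,1)$: $$\Psi(2,\{\alpha_i\}_{i=1}^2,K,\delta):=\Phi(\alpha_1,\alpha_2,K,\delta),$$ $$\Psi(m+1,\{\alpha_i\}_{i=1}^{m+1},K,\delta):=\Phi\big(\alpha_1\star\cdots\star\alpha_m,\ \alpha_{m+1},\ \rho\mapsto\max(\Psi(m,\{\alpha_i\}_{i=1}^m,K,\rho),K(\rho)),\ \delta\big).$$ The function $\varphi$. For $\varepsilon, b, d > 0$, $\alpha : (0, \infty) \to (0, \infty)$ and $\omega:(0,\infty) \times (0,\infty) \to (0,\infty)$, $$\varphi(\varepsilon,b,d,\alpha,\omega):=\left\lceil \frac{18b + 12\alpha(\varepsilon/6)}\varepsilon-1\right\rceil \cdot \left\lceil \frac{d}{\omega\left(d,\frac{\varepsilon^2}{27b + 18\alpha(\varepsilon/6)}\right)} \right\rceil.$$ The functions $\omega_\alpha$. For $\alpha \in (0,1)$ and $b,\varepsilon > 0$, $\omega_\alpha(b,\varepsilon):=\frac{1-\alpha}{4b\alpha} \cdot \varepsilon^2$. Rate of asymptotic regularity. For a sequence $(x_n)$ in $X$ and $T: X \to X$, it is a function $\Sigma : (0,\infty) \to \mathbb{N}$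 such that $\|x_n - Tx_n\| \le \varepsilon$ for all $\varepsilon>0$ and all $n \ge \Sigma(\varepsilon)$. *)

(* Defs.v *)
From mathcomp Require Import all_boot all_order all_algebra.
From mathcomp Require Import all_classical all_reals all_analysis.

Set Implicit Arguments.
Unset Strict Implicit.
Unset Printing Implicit Defensive.

Import Order.TTheory GRing.Theory Num.Theory.
Import numFieldNormedType.Exports.

Local Open Scope ring_scope.

(* Functions on (0, +oo) are total functions R -> R that are only evaluated at
   positive arguments.  Finite families indexed by 1, ..., m are functions on
   nat of which only the values at 1, ..., m are used. *)

Section Mappings.
Context {R : realType} {X : normedModType R}.

Definition nonexpansive (T : X -> X) : Prop :=
  forall x y : X, `|T x - T y| <= `|x - y|.

Definition averaged (a : R) (S : X -> X) : Prop :=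
  exists T : X -> X,
    nonexpansive T /\ forall x : X, S x = (1 - a) *: x + a *: T x.

(* S m \o ... \o S 1 *)
Fixpoint comp_upto (m : nat) (S : nat -> X -> X) : X -> X :=
  if m is n.+1 then S n.+1 \o comp_upto n S else idfun.

(* The rate is an integer-valued function, so that products of ceilings can be
   written literally; its values at positive arguments are required to be
   natural numbers. *)
Definition rate_of_asymptotic_regularity
    (u : nat -> X) (T : X -> X) (Sigma : R -> int) : Prop :=
  forall eps : R, 0 < eps ->
    0 <= Sigma eps /\
    forall n : nat, Sigma eps <= n%:Z -> `|u n - T (u n)| <= eps.

End Mappings.

Section Bounds.
Context {R : realType}.

Definition star (a b : R) : R := (a + b - 2 * a * b) / (1 - a * b).

(* a 1 `star` ... `star` a m, nested to the left; the case m = 0 is junk *)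
Fixpoint bigstar (m : nat) (a : nat -> R) : R :=
  match m with
  | 0 => 0
  | 1 => a 1%N
  | n.+1 => star (bigstar n a) (a n.+1)
  end.

Definition Theta (beta L1 L2 L3 : R) : R :=
  (L1 + L2) *
  (L3 + (L1 + L2 + 2 * beta * L3
         + Num.sqrt (L1 ^+ 2 + L2 ^+ 2 + 2 * L1 * L2
                     + 8 * beta * L1 * L3 + 4 * beta * L2 * L3))
        / (2 * beta)).

Definition B (a2 : R) (K : R -> R) (delta : R) : R :=
  Num.sqrt ((K (delta / 4) + delta / 8) ^+ 2
            + 2 * Theta (a2^-1 - 1) (K (delta / 4) + delta / 8)
                        (K (delta / 4) + delta / 8) (delta / 8)).

Definition Phi (a1 a2 : R) (K : R -> R) (delta : R) : R :=
  B a2 K delta * Num.max (Num.sqrt 2) (4 * B a2 K delta / delta)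
    * (1 / (1 - a1))
  + a1 / (1 - a1) * (K (delta / 4) + delta / 8) + delta / 8.

(* the cases m = 0 and m = 1 are junk *)
Fixpoint Psi (m : nat) (a : nat -> R) (K : R -> R) (delta : R) : R :=
  match m with
  | 0 | 1 => 0
  | 2 => Phi (a 1%N) (a 2%N) K delta
  | n.+1 => Phi (bigstar n a) (a n.+1)
                (fun rho => Num.max (Psi n a K rho) (K rho)) delta
  end.

Definition phi (eps b d : R) (al : R -> R) (om : R -> R -> R) : int :=
  Num.ceil ((18 * b + 12 * al (eps / 6)) / eps - 1)
  * Num.ceil (d / om d (eps ^+ 2 / (27 * b + 18 * al (eps / 6)))).

Definition omega (a b eps : R) : R := (1 - a) / (4 * b * a) * eps ^+ 2.

Definition Sigma (m : nat) (a : nat -> R) (K : R -> R) (b d eps : R) : int :=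
  phi eps b d (Psi m a K) (omega (bigstar m a)).

End Bounds.

(* Main.v *)
Require Import Defs.
From mathcomp Require Import all_boot all_order all_algebra.
From mathcomp Require Import all_classical all_reals all_analysis.
From mathcomp Require Import ring lra.

Import Order.TTheory GRing.Theory Num.Theory.
Import numFieldNormedType.Exports.

Local Open Scope ring_scope.

(* Write x - S x for the displacement of S.  An a-averaged map satisfies
   |S x - S y|^2 + k |(x - S x) - (y - S y)|^2 <= |x - y|^2 with k = (1-a)/a,
   and under composition the constants k combine harmonically, which is the
   operation star.

   An approximate fixed point of T o S near p is obtained as the fixed point x
   of the contraction x |-> (T (S x) + s p) / (1 + s).  Testing S against p and
   T against q, where p, q are approximate fixed points of S and T, bounds
   s |x - p|^2 in terms of |q - p|^2 / k only; the choice of s then makes the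
   displacement s |x - p| small while |x - p| stays below Phi.

   Asymptotic regularity follows by the Bruck-Reich argument: displacements
   have nonincreasing norms, so they are almost constant along some long run,
   whereas an approximate fixed point keeps the average drift along any long
   run small. *)

Definition displacement_bound {R : realType} {X : normedModType R}
    (k : R) (S : X -> X) : Prop :=
  forall x y : X, `|S x - S y| ^+ 2 + k * `|(x - S x) - (y - S y)| ^+ 2
                  <= `|x - y| ^+ 2.

Definition has_approx_fixpoints {R : realType} {X : normedModType R}
    (K : R -> R) (T : X -> X) : Prop :=
  forall e : R, 0 < e -> exists p : X, `|p| <= K e /\ `|p - T p| <= e.

Lemma displacement_bound_nonexpansive {R : realType} {X : normedModType R}
    {k : R} {S : X -> X} :
  0 <= k -> displacement_bound k S -> nonexpansive S.
Proof.
move=> k0 bS x y; rewrite -(ler_pXn2r (ltn0Sn 1)) ?nnegrE //.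
by apply: le_trans (bS x y); rewrite lerDl mulr_ge0 ?sqr_ge0.
Qed.

(** * Displacement bounds in Hilbert spaces *)

Section InnerProduct.
Context {R : realType} {X : completeNormedModType R} (dot : {dot X for idfun}).
Context (dot_norm : forall x : X, dot x x = `|x| ^+ 2).

Lemma dotC (x y : X) : dot x y = dot y x.
Proof. by rewrite hermC expr0 mul1r. Qed.

Lemma dotDl (x y z : X) : dot (x + y) z = dot x z + dot y z.
Proof. exact: linearDl. Qed.

Lemma dotZl (a : R) (x y : X) : dot (a *: x) y = a * dot x y.
Proof. exact: linearZl_LR. Qed.

Lemma dotNl (x y : X) : dot (- x) y = - dot x y.
Proof. exact: linearNl. Qed.

Lemma dotDr (x y z : X) : dot x (y + z) = dot x y + dot x z.
Proof. by rewrite dotC dotDl !(dotC x). Qed.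

Lemma dotZr (a : R) (x y : X) : dot x (a *: y) = a * dot x y.
Proof. by rewrite dotC dotZl dotC. Qed.

Lemma dotNr (x y : X) : dot x (- y) = - dot x y.
Proof. by rewrite dotC dotNl dotC. Qed.

Lemma sqr_normD (x y : X) :
  `|x + y| ^+ 2 = `|x| ^+ 2 + 2 * dot x y + `|y| ^+ 2.
Proof. by rewrite -!dot_norm dotDl !dotDr (dotC y x); ring. Qed.

Lemma sqr_normB (x y : X) :
  `|x - y| ^+ 2 = `|x| ^+ 2 - 2 * dot x y + `|y| ^+ 2.
Proof. by rewrite sqr_normD dotNr normrN; ring. Qed.

Lemma sqr_normZ (a : R) (x : X) : `|a *: x| ^+ 2 = a ^+ 2 * `|x| ^+ 2.
Proof. by rewrite normrZ exprMn real_normK ?num_real. Qed.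

(** Cauchy-Schwarz is read off from the triangle inequality, since the norm is given first and [dot]
    is tied to it by [dot_norm]. *)
Lemma dot_le (x y : X) : dot x y <= `|x| * `|y|.
Proof.
have : `|x + y| ^+ 2 <= (`|x| + `|y|) ^+ 2.
  by rewrite ler_pXn2r ?nnegrE ?addr_ge0 ?ler_normD.
rewrite sqr_normD sqrrD; lra.
Qed.

(** For u = x - y and v = T x - T y, the identity |(1-a) u + a v|^2 = (1-a) |u|^2 + a |v|^2 - a
    (1-a) |u - v|^2 makes the displacement term cancel exactly. *)
Lemma averaged_displacement_bound (a : R) (S : X -> X) :
  0 < a -> a < 1 -> averaged a S -> displacement_bound ((1 - a) / a) S.
Proof.
move=> a0 a1 [T [neT ST]] x y.
have leT : `|T x - T y| ^+ 2 <= `|x - y| ^+ 2 by rewrite ler_pXn2r ?nnegrE.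
have -> : S x - S y = (1 - a) *: (x - y) + a *: (T x - T y).
  by rewrite !ST !scalerBr opprD addrACA.
have -> : (x - S x) - (y - S y) = a *: ((x - y) - (T x - T y)).
  have ES z : z - S z = a *: (z - T z).
    by rewrite ST scalerBl scale1r scalerBr opprD addrA subKr.
  by rewrite !ES -scalerBr !opprD addrACA.
move: (x - y) (T x - T y) leT => u v leT.
rewrite sqr_normD !sqr_normZ dotZl dotZr sqr_normB.
have -> : (1 - a) / a * (a ^+ 2 * (`|u| ^+ 2 - 2 * dot u v + `|v| ^+ 2))
    = (1 - a) * a * (`|u| ^+ 2 - 2 * dot u v + `|v| ^+ 2).
  by field; rewrite gt_eqF.
have := ler_wpM2l (ltW a0) leT; lra.
Qed.

Lemma displacement_bound_comp (k l : R) (S T : X -> X) :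
  0 < k -> 0 < l -> displacement_bound k S -> displacement_bound l T ->
  displacement_bound (k * l / (k + l)) (T \o S).
Proof.
move=> k0 l0 bS bT x y /=.
have := bS x y; have := bT (S x) (S y).
set u := (x - S x) - (y - S y); set v := (S x - T (S x)) - (S y - T (S y)).
have -> : (x - T (S x)) - (y - T (S y)) = u + v.
  rewrite /u /v -[x - T (S x)](subrKA (S x)) -[y - T (S y)](subrKA (S y)).
  by rewrite opprD addrACA.
move=> Hv Hu.
suff Huv : k * l / (k + l) * `|u + v| ^+ 2 <= k * `|u| ^+ 2 + l * `|v| ^+ 2.
  lra.
have kl0 : 0 < k + l by rewrite addr_gt0.
rewrite mulrAC ler_pdivrMr // sqr_normD.
(* Cleared of its denominator, the inequality says that |k u - l v|^2 is nonnegative. *)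
have := sqr_ge0 `|k *: u - l *: v|.
rewrite sqr_normB !sqr_normZ dotZl dotZr; nra.
Qed.

Lemma contraction_fixpoint (q : R) (f : X -> X) :
  0 <= q -> q < 1 -> (forall x y, `|f x - f y| <= q * `|x - y|) ->
  exists x, x = f x.
Proof.
move=> q0 q1 fq.
pose F : {fun [set: X] >-> [set: X]} := totalfun f.
have ctrF : is_contraction F.
  exists (NngNum q0); split=> //= -[x y] _ /=; exact: fq.
have [|x _ Fx] := banach_fixed_point ctrF closedT; first by exists 0.
by exists x.
Qed.

Lemma approx_fixpoint_comp (k delta r : R) (S T : X -> X) (p q : X) :
  0 < k -> 0 < delta -> 0 < r -> nonexpansive S -> displacement_bound k T ->
  `|p - S p| <= delta / 4 -> `|q - T q| <= delta / 4 ->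
  `|q - p| + delta / 4 <= r ->
  exists x : X, `|x - p| <= r ^+ 2 / (k * delta) /\ `|x - T (S x)| <= delta.
Proof.
move=> k0 d0 r0 neS bT pS qT qp.
have neT := displacement_bound_nonexpansive (ltW k0) bT.
pose C := r ^+ 2 / k.
have C0 : 0 < C by rewrite divr_gt0 ?exprn_gt0.
(* Chosen so that s C = delta^2: then [key] below forces s |x - p| <= delta, hence also |x - p| <=
   delta / s = C / delta. *)
pose s := delta ^+ 2 / C.
have s0 : 0 < s by rewrite divr_gt0 ?exprn_gt0.
have s1 : 0 < 1 + s by rewrite addr_gt0.
pose f x := (1 + s)^-1 *: (T (S x) + s *: p).
have [|||x fx] := @contraction_fixpoint (1 + s)^-1 f.
- by rewrite invr_ge0 ltW.
- by rewrite invf_lt1 // ltrDl.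
- move=> x y; rewrite -scalerBr opprD addrACA subrr addr0 normrZ.
  rewrite gtr0_norm ?invr_gt0 //.
  by rewrite ler_pM2l ?invr_gt0 // (le_trans (neT _ _)).
have {f} fx : x - T (S x) = - (s *: (x - p)).
  have : (1 + s) *: x = T (S x) + s *: p.
    by rewrite {1}fx scalerA divff ?gt_eqF // scale1r.
  rewrite scalerDl scale1r => h; apply: (addIr (s *: x)).
  by rewrite /= scalerBr opprB subrK addrAC h [_ + s *: p]addrC addrK.
set X0 := x - p in fx *.
set e := p - S p in pS; set e' := q - T q in qT.
(* [z] compares the displacements of S at x and p, [w] those of T at S x and q; [c] equals q - S
   p. *)
set z := (x - S x) - e; set w := (S x - T (S x)) - e'; set c := (q - p) + e.
have subBB (a b a' b' : X) : (a - b) - ((a - a') - (b - b')) = a' - b'.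
  by rewrite [- (b - b')]opprD [a - a' + _]addrACA -opprD subKr.
have zw : w = - (s *: X0) - (e + e') - z.
  apply: (addIr z); rewrite /= subrK addrC /z /w [LHS]addrACA -fx.
  by rewrite subrKA -opprD.
have Sdiff : S x - S p = X0 - z by rewrite subBB.
have Vdiff : S x - q = X0 - z - c.
  by rewrite -Sdiff /c /e subrKA opprB subrKA.
have Tdiff : T (S x) - T q = X0 - z - c - w by rewrite -Vdiff subBB.
have Hz : `|X0 - z| ^+ 2 <= `|X0| ^+ 2.
  by rewrite -Sdiff ler_pXn2r ?nnegrE ?neS.
have Hw := bT (S x) q; rewrite Tdiff Vdiff -/w in Hw.
have ze : `|e + e'| <= delta / 2.
  by apply: le_trans (ler_normD _ _) _; lra.
have cr : `|c| <= r by apply: le_trans (ler_normD _ _) _; lra.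
exists x; rewrite -[x - p]/X0 fx normrN normrZ gtr0_norm //.
clearbody z w c e e' X0.
have kC : k * C = r ^+ 2 by rewrite /C mulrC divfK ?gt_eqF.
(* [Hz] amounts to |z|^2 <= 2 <X0, z>. Added to [Hw] with [zw] substituted, it cancels <X0, z> and
   completes the square |z + w|^2, which is dropped. *)
have key : 2 * s * `|X0| ^+ 2 <= delta * `|X0| + C.
  have c2 : `|c| ^+ 2 <= r ^+ 2 by rewrite ler_pXn2r ?nnegrE // ltW.
  have Xe : - dot X0 (e + e') <= `|X0| * `|e + e'|.
    by rewrite -dotNr -[`|e + e'|]normrN dot_le.
  have Xe' : `|X0| * `|e + e'| <= `|X0| * (delta / 2) by rewrite ler_wpM2l.
  have dotXw : dot X0 w = - (s * `|X0| ^+ 2) - dot X0 (e + e') - dot X0 z.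
    by rewrite zw !(dotDr, dotNr) dotZr dot_norm; ring.
  (* Young's inequality for the cross term 2 <c, w>. *)
  have cw := sqr_ge0 `|c + k *: w|.
  have zw0 := sqr_ge0 `|z + w|.
  rewrite sqr_normD sqr_normZ dotZr in cw; rewrite sqr_normD in zw0.
  rewrite sqr_normB in Hz.
  rewrite (sqr_normB _ w) !(dotDl, dotNl) in Hw.
  have {}cw : 0 <= C + 2 * dot c w + k * `|w| ^+ 2.
    rewrite -(pmulr_rge0 _ k0) !mulrDr kC; lra.
  lra.
have sX : s * `|X0| <= delta.
  have sC : s * C = delta ^+ 2 by rewrite /s divfK ?gt_eqF.
  rewrite leNgt; apply/negP => sX.
  have : s * (s * `|X0| ^+ 2) < s * C.
    rewrite ltr_pM2l //.
    have X1 : 0 < `|X0| by rewrite -(pmulr_rgt0 _ s0) (lt_trans d0).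
    have : delta * `|X0| < s * `|X0| * `|X0| by rewrite ltr_pM2r.
    lra.
  rewrite sC; nra.
split=> //.
rewrite -(ler_pM2l s0); apply: le_trans sX _; rewrite /s /C le_eqVlt.
by apply/orP; left; apply/eqP; field; rewrite !gt_eqF.
Qed.

End InnerProduct.

(** * Orbits of maps with bounded displacement *)

Lemma small_drop (R : realType) (u : nat -> R) (N : nat) (w : R) :
  (0 < N)%N -> (forall j, 0 <= u j) -> u 0%N <= N%:R * w ->
  exists2 j, (j < N)%N & u j - u j.+1 <= w.
Proof.
move=> N0 u0 uN; apply: contrapT => noj.
have drop j : (j < N)%N -> w < u j - u j.+1.
  by move=> jN; rewrite ltNge; apply/negP => ujw; apply: noj; exists j.
have le_uj j : (j <= N)%N -> u j <= (N%:R - j%:R) * w.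
  elim: j => [|j IH] jN; first by rewrite subr0.
  by have := IH (ltnW jN); have := drop j jN; rewrite -natr1; lra.
(* The bound at the last index but one, followed by one more strict drop, makes the final value
   negative. *)
case: N N0 {uN noj} drop le_uj => // N _ drop le_uj.
have := le_uj N (leqnSn N); have := drop N (ltnSn N); have := u0 N.+1.
by rewrite -natr1; lra.
Qed.

Section Orbits.
Context {R : realType} {X : normedModType R}.

Lemma iter_nonexpansive {T : X -> X} (n : nat) :
  nonexpansive T -> nonexpansive (iter n T).
Proof.
move=> neT; elim: n => [//|n IH] x y.
by rewrite !iterS (le_trans (neT _ _)).
Qed.

Lemma iter_approx_fixpoint {T : X -> X} {p : X} {e : R} (n : nat) :
  nonexpansive T -> `|p - T p| <= e -> `|iter n T p - p| <= n%:R * e.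
Proof.
move=> neT pe; elim: n => [|n IH]; first by rewrite subrr normr0 mul0r.
rewrite iterS -natr1 mulrDl mul1r -(subrKA (T p)).
apply: le_trans (ler_normD _ _) _; apply: lerD; last by rewrite distrC.
exact: le_trans (neT _ _) IH.
Qed.

(* Along a run of N1 steps with little drop in |v|, the displacement v is almost
   constant, so N v_k is close to x_k - x_(k + N) for N = N1 + 1.  Since x_k may
   drift away, the latter is compared by nonexpansiveness with x - x_N, whose
   norm is at most 2 |x - p| + N eps / 6. *)
Lemma displacement_bound_rate (T : X -> X) (c eps b al d M : R) (x p : X)
    (N1 N2 : nat) :
  0 < c -> displacement_bound c T -> 0 < eps -> 0 < d -> 0 < M ->
  `|p| <= al -> `|p - T p| <= eps / 6 -> `|x| <= b -> `|x - T x| <= d ->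
  2 * (b + al) <= M -> 6 * M <= eps * N1.+1%:R -> eps * N1%:R <= 6 * M ->
  (0 < N2)%N -> d <= N2%:R * (c / (4 * d) * (eps ^+ 2 / (9 * M)) ^+ 2) ->
  forall n, (N1 * N2 <= n)%N -> `|iter n T x - T (iter n T x)| <= eps.
Proof.
move=> c0 bT e0 d0 M0 pal pe xb xd bM lbN1 ubN1 N20 dN2.
have neT := displacement_bound_nonexpansive (ltW c0) bT.
pose v n := iter n T x - T (iter n T x).
have v_anti i j : (i <= j)%N -> `|v j| <= `|v i|.
  move=> /subnKC <-; elim: (j - i)%N => [|n IH]; first by rewrite addn0.
  by rewrite addnS; apply: le_trans IH; rewrite /v /= neT.
have v_le_d n : `|v n| <= d by apply: le_trans (v_anti 0%N n _) xd.
(* This size gives N1 eta <= 2/3 eps, because eps N1 <= 6 M. *)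
set eta := eps ^+ 2 / (9 * M) in dN2.
have eta0 : 0 < eta by rewrite divr_gt0 ?exprn_gt0 // mulr_gt0.
(* Sampled at the ends of N2 blocks of length N1, |v| starts at most d, so it drops by at most c
   eta^2 / (4 d) over some block. *)
have [j jN2] := @small_drop R (fun j => `|v (j * N1)%N|) N2 _ N20
  (fun j => normr_ge0 _) (le_trans (v_le_d _) dN2).
rewrite mulSn addnC; set k := (j * N1)%N => drop n leN.
have kn : (k <= n)%N by rewrite (leq_trans _ leN) // /k mulnC leq_mul // ltnW.
apply: le_trans (v_anti _ _ kn) _ => {n leN kn}.
have step i : (i < N1)%N -> `|v (k + i)%N - v (k + i).+1| <= eta.
  move=> iN1; rewrite -(ler_pXn2r (ltn0Sn 1)) ?nnegrE ?(ltW eta0) //.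
  rewrite -(ler_pM2l c0).
  have bTv : `|v (k + i).+1| ^+ 2 + c * `|v (k + i)%N - v (k + i).+1| ^+ 2
      <= `|v (k + i)%N| ^+ 2 := bT (iter (k + i) T x) (iter (k + i).+1 T x).
  have v0 := v_anti _ _ (leqnSn (k + i)).
  have v1 := v_anti k (k + i)%N (leq_addr _ _).
  have v2 : `|v (k + N1)%N| <= `|v (k + i).+1|.
    by rewrite v_anti // -addnS leq_add2l.
  have v3 := v_le_d (k + i)%N; have v4 := v_le_d (k + i).+1.
  (* Factor the difference of squares: the drop is at most c eta^2 / (4 d) and the sum at most 2 d,
     so the product is at most c eta^2 / 2. *)
  have sum_le : (`|v (k + i)%N| - `|v (k + i).+1|) *
      (`|v (k + i)%N| + `|v (k + i).+1|) <=
      (`|v (k + i)%N| - `|v (k + i).+1|) * (2 * d) by rewrite ler_wpM2l; lra.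
  have diff_le : (`|v (k + i)%N| - `|v (k + i).+1|) * (2 * d) <=
      c / (4 * d) * eta ^+ 2 * (2 * d) by rewrite ler_wpM2r; lra.
  have d4 : c / (4 * d) * eta ^+ 2 * (2 * d) = c * eta ^+ 2 / 2.
    by field; rewrite gt_eqF.
  have ceta := mulr_gt0 c0 (exprn_gt0 2 eta0).
  lra.
have near_v i : (i <= N1)%N -> `|v k - v (k + i)%N| <= i%:R * eta.
  elim: i => [|i IH] iN; first by rewrite addn0 subrr normr0 mul0r.
  rewrite -(subrKA (v (k + i)%N)) -natr1 mulrDl mul1r addnS.
  by apply: le_trans (ler_normD _ _) _; rewrite lerD ?step ?IH // ltnW.
(* x_k - x_(k+i) telescopes into v_k + ... + v_(k+i-1), and the errors from [near_v] add up to (0 +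
   1 + ... + (i-1)) eta. *)
have near_Nv i : (i <= N1.+1)%N ->
    `|(iter k T x - iter (k + i) T x) - i%:R *: v k|
      <= i%:R * (i%:R - 1) / 2 * eta.
  elim: i => [|i IH] iN.
    by rewrite addn0 subrr scale0r subr0 normr0 !mul0r.
  have -> : iter k T x - iter (k + i.+1) T x - i.+1%:R *: v k =
     (iter k T x - iter (k + i) T x - i%:R *: v k) - (v k - v (k + i)%N).
    rewrite -natr1 scalerDl scale1r addnS opprD [- (v k - _)]opprB [RHS]addrACA.
    by rewrite subrKA.
  apply: le_trans (ler_normB _ _) _.
  by have := IH (ltnW iN); have := near_v i iN; rewrite -(natr1 i); lra.
have far : `|iter k T x - iter (k + N1.+1) T x|
    <= 2 * (b + al) + N1.+1%:R * (eps / 6).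
  rewrite iterD; apply: le_trans (iter_nonexpansive k neT _ _) _.
  have xp : `|x - p| <= b + al by apply: le_trans (ler_normB _ _) (lerD xb pal).
  have := iter_nonexpansive N1.+1 neT x p.
  have := iter_approx_fixpoint N1.+1 neT pe.
  have := ler_normB (x - p) (iter N1.+1 T x - p).
  rewrite opprB addrA subrK.
  have := ler_normD (iter N1.+1 T x - iter N1.+1 T p) (iter N1.+1 T p - p).
  rewrite subrKA; lra.
(* Divided by N1 + 1, the errors 2 (b + al), (N1 + 1) eps / 6 and (N1 + 1) N1 eta / 2 are at most
   eps/6, eps/6 and eps/3. *)
have N10 : 0 < N1.+1%:R :> R by [].
rewrite -(ler_pM2l N10).
have -> : N1.+1%:R * `|v k| = `|N1.+1%:R *: v k| by rewrite normrZ ger0_norm.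
have := ler_normB (iter k T x - iter (k + N1.+1) T x)
  (iter k T x - iter (k + N1.+1) T x - N1.+1%:R *: v k).
rewrite subKr => /le_trans; apply.
have : N1%:R * eta <= 2 / 3 * eps.
  rewrite /eta mulrA ler_pdivrMr ?mulr_gt0 //.
  by have := ler_wpM2l (ltW e0) ubN1; lra.
move=> /(ler_wpM2l (ltW N10)).
have := near_Nv N1.+1 (leqnn _); have : N1.+1%:R - 1 = N1%:R :> R.
  by rewrite -natr1 addrK.
move=> ->; lra.
Qed.

End Orbits.

(** * The parameters of averaged compositions *)

Section Coefficients.
Context {R : realType}.

Lemma ratio_gt0 (a : R) : 0 < a < 1 -> 0 < (1 - a) / a.
Proof. by move=> /andP[a0 a1]; rewrite divr_gt0 ?subr_gt0. Qed.

Lemma bigstarS (n : nat) (a : nat -> R) :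
  bigstar n.+2 a = star (bigstar n.+1 a) (a n.+2).
Proof. by []. Qed.

Lemma PsiS (n : nat) (a : nat -> R) (K : R -> R) (delta : R) :
  Psi n.+3 a K delta = Phi (bigstar n.+2 a) (a n.+3)
    (fun rho => Num.max (Psi n.+2 a K rho) (K rho)) delta.
Proof. by []. Qed.

Lemma star_itv (a b : R) : 0 < a < 1 -> 0 < b < 1 -> 0 < star a b < 1.
Proof.
move=> /andP[a0 a1] /andP[b0 b1]; rewrite /star.
have ab : 0 < 1 - a * b by nra.
by rewrite divr_gt0 ?ltr_pdivrMr //; nra.
Qed.

(** This matches [star] with the constant produced by [displacement_bound_comp]. *)
Lemma star_ratio (a b : R) : 0 < a < 1 -> 0 < b < 1 ->
  (1 - star a b) / star a b =
  ((1 - a) / a) * ((1 - b) / b) / ((1 - a) / a + (1 - b) / b).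
Proof.
move=> /andP[a0 a1] /andP[b0 b1]; rewrite /star.
have ab : 0 < 1 - a * b by nra.
have ab' : 0 < a + b - 2 * a * b by nra.
field; rewrite !gt_eqF //; nra.
Qed.

Lemma bigstar_itv (m : nat) (a : nat -> R) : (0 < m)%N ->
  (forall i : nat, (1 <= i <= m)%N -> 0 < a i < 1) -> 0 < bigstar m a < 1.
Proof.
case: m => // m _; elim: m => [|m IH] am; first exact: am.
rewrite bigstarS star_itv ?am ?leqnn // IH // => i /andP[i0 im].
by rewrite am // i0 leqW.
Qed.

(** The left-hand side bounds the norm of the point found by [approx_fixpoint_comp]: the first term
    bounds |p|, the second its distance to p, with r = 2 (K (delta / 4) + delta / 8). *)
Lemma Phi_ge (a1 a2 : R) (K : R -> R) (delta : R) :
  0 < a1 < 1 -> 0 < a2 < 1 -> 0 < delta -> 0 < K (delta / 4) ->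
  K (delta / 4) + (2 * (K (delta / 4) + delta / 8)) ^+ 2
    / ((1 - a2) / a2 * delta) <= Phi a1 a2 K delta.
Proof.
move=> /andP[a10 a11] /andP[a20 a21] d0; set L := K _ => L0.
set k := L + delta / 8; set be : R := (1 - a2) / a2.
have k0 : 0 < k by rewrite /k; lra.
have be0 : 0 < be by rewrite divr_gt0 ?subr_gt0.
have beE : a2^-1 - 1 = be by rewrite /be; field; rewrite gt_eqF.
clearbody be.
(* Theta is bounded below by discarding the terms containing delta. *)
have ThetaG : 4 * k ^+ 2 / be <= Theta be k k (delta / 8).
  rewrite /Theta; set s := Num.sqrt _; have s0 : 0 <= s := sqrtr_ge0 _.
  rewrite [leRHS](_ : _ = 4 * k ^+ 2 / be * (2^-1) + (k + k) * (delta / 4) +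
    k * s / be); last by field; rewrite gt_eqF.
  have s2k : 2 * k <= s.
    have kd : 0 <= be * k * delta by rewrite !mulr_ge0 ?ltW.
    rewrite -(ler_pXn2r (ltn0Sn 1)) ?nnegrE //; last by lra.
    rewrite sqr_sqrtr; nra.
  have : k * (2 * k) / be <= k * s / be.
    by rewrite ler_pM2r ?invr_gt0 // ler_pM2l.
  have : 0 <= k * delta by rewrite mulr_ge0 ?ltW.
  lra.
have k2be : 0 < k ^+ 2 / be by rewrite divr_gt0 ?exprn_gt0.
have k2 : 0 < k ^+ 2 by rewrite exprn_gt0.
have BE : B a2 K delta ^+ 2 = k ^+ 2 + 2 * Theta be k k (delta / 8).
  by rewrite /B -/L -/k beE sqr_sqrtr //; lra.
rewrite /Phi -/L -/k; set b := B _ _ _ in BE *.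
have b0 : 0 <= b := sqrtr_ge0 _.
have bk : k <= b.
  by rewrite -(ler_pXn2r (ltn0Sn 1)) ?nnegrE ?(ltW k0) // BE; lra.
(* A rational bound above 1 leaves room to average [bmx1] and [bmx2] at the end: weights 6/7 and 1/7
   already cover k and the quadratic term. *)
have r2 : 7 / 5 <= Num.sqrt 2 :> R.
  by rewrite -(ler_pXn2r (ltn0Sn 1)) ?nnegrE ?sqrtr_ge0 ?sqr_sqrtr //; lra.
set mx := Num.max _ _.
have mx1 : Num.sqrt 2 <= mx by rewrite le_max lexx.
have mx2 : 4 * b / delta <= mx by rewrite le_max lexx orbT.
have a1' : 1 <= 1 / (1 - a1) by rewrite ler_pdivlMr; lra.
have bmx : b * mx <= b * mx * (1 / (1 - a1)).
  by rewrite ler_peMr // mulr_ge0 //; lra.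
have a1k : 0 <= a1 / (1 - a1) * k by rewrite mulr_ge0 ?divr_ge0; lra.
have bmx1 : k * (7 / 5) <= b * mx by rewrite ler_pM //; lra.
have bmx2 : 4 * (k ^+ 2 + 8 * (k ^+ 2 / be)) / delta <= b * mx.
  apply: (@le_trans _ _ (b * (4 * b / delta))); last by rewrite ler_wpM2l.
  rewrite [leRHS]mulrA ler_pM2r ?invr_gt0 // [leRHS]mulrCA.
  rewrite ler_pM2l // -expr2 BE; lra.
have -> : (2 * k) ^+ 2 / (be * delta) = 4 * (k ^+ 2 / be) / delta.
  by field; rewrite !gt_eqF.
have : 4 * (8 * (k ^+ 2 / be)) / delta <= b * mx.
  by apply: le_trans bmx2; rewrite ler_pM2r ?invr_gt0 //; lra.
have : 0 < k ^+ 2 / be / delta by rewrite divr_gt0.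
move: bmx bmx1 a1k; rewrite /k; lra.
Qed.

Lemma Phi_gt0 (a1 a2 : R) (K : R -> R) (delta : R) :
  0 < a1 < 1 -> 0 < a2 < 1 -> 0 < delta -> 0 < K (delta / 4) ->
  0 < Phi a1 a2 K delta.
Proof.
move=> a1_itv a2_itv d0 K0; apply: lt_le_trans (Phi_ge _ _ _ _ _ _ _ K0) => //.
by rewrite ltr_pwDl // divr_ge0 ?sqr_ge0 // mulr_ge0 ?ltW // ratio_gt0.
Qed.

Lemma Psi_gt0 (m : nat) (a : nat -> R) (K : R -> R) (delta : R) :
  (2 <= m)%N -> (forall i : nat, (1 <= i <= m)%N -> 0 < a i < 1) ->
  (forall e : R, 0 < e -> 0 < K e) -> 0 < delta -> 0 < Psi m a K delta.
Proof.
case: m => [|[|[|m]]] // _ a_itv K0 d0.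
  by rewrite Phi_gt0 ?a_itv ?K0 ?divr_gt0.
rewrite PsiS Phi_gt0 ?a_itv ?leqnn //.
  by apply: bigstar_itv => // i /andP[i0 im]; rewrite a_itv // i0 leqW.
by rewrite lt_max K0 ?orbT ?divr_gt0.
Qed.

End Coefficients.

(** * Compositions of finite families of averaged maps *)

Section AveragedFamily.
Context {R : realType} {X : completeNormedModType R} (dot : {dot X for idfun}).
Context (dot_norm : forall x : X, dot x x = `|x| ^+ 2).

Lemma approx_fixpoints_comp (a1 a2 : R) (K : R -> R) (S T : X -> X) :
  0 < a1 < 1 -> 0 < a2 < 1 -> (forall e : R, 0 < e -> 0 < K e) ->
  nonexpansive S -> averaged a2 T ->
  has_approx_fixpoints K S -> has_approx_fixpoints K T ->
  has_approx_fixpoints (Phi a1 a2 K) (T \o S).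
Proof.
move=> a1_itv a2_itv K0 neS avT fixS fixT delta d0.
have d40 : 0 < delta / 4 by rewrite divr_gt0.
have [p [pK pS]] := fixS _ d40; have [q [qK qT]] := fixT _ d40.
have bT : displacement_bound ((1 - a2) / a2) T.
  by move: (a2_itv) => /andP[? ?]; apply: averaged_displacement_bound.
have leP := Phi_ge _ _ _ _ a1_itv a2_itv d0 (K0 _ d40).
(* r equals 2 K (delta / 4) + delta / 4, which dominates |q| + |p| + delta / 4. *)
set r := 2 * _ in leP.
have r0 : 0 < r by have := K0 _ d40; rewrite /r; lra.
have [|y [yp yS]] := approx_fixpoint_comp dot dot_norm _ _ r _ _ p q
  (ratio_gt0 _ a2_itv) d0 r0 neS bT pS qT.
  by apply: le_trans (lerD (ler_normB _ _) (lexx _)) _; rewrite /r; lra.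
by exists y; split=> //; have := ler_normD (y - p) p; rewrite subrK; lra.
Qed.

Context (m : nat) (alpha : nat -> R) (S : nat -> X -> X).
Context (alpha_itv : forall i : nat, (1 <= i <= m)%N -> 0 < alpha i < 1).
Context (avS : forall i : nat, (1 <= i <= m)%N -> averaged (alpha i) (S i)).

Lemma bigstar_le_itv (n : nat) : (1 <= n <= m)%N -> 0 < bigstar n alpha < 1.
Proof.
move=> /andP[n0 nm]; apply: bigstar_itv => // i /andP[i0 i_n].
by rewrite alpha_itv // i0 (leq_trans i_n).
Qed.

Lemma comp_upto_displacement_bound (n : nat) : (1 <= n <= m)%N ->
  displacement_bound ((1 - bigstar n alpha) / bigstar n alpha) (comp_upto n S).
Proof.
have bS i : (1 <= i <= m)%N ->
    displacement_bound ((1 - alpha i) / alpha i) (S i).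
  move=> im; have /andP[a0 a1] := alpha_itv i im.
  exact: averaged_displacement_bound dot dot_norm _ _ a0 a1 (avS i im).
case: n => // n; elim: n => [|n IH] nm; first exact: bS.
have nm' : (1 <= n.+1 <= m)%N := ltnW nm.
rewrite bigstarS star_ratio ?bigstar_le_itv ?alpha_itv //.
by apply: displacement_bound_comp dot dot_norm _ _ _ _ _ _ (IH nm') (bS _ nm);
  rewrite ratio_gt0 ?bigstar_le_itv ?alpha_itv.
Qed.

Lemma comp_upto_approx_fixpoints (K : R -> R) (n : nat) : (2 <= n <= m)%N ->
  (forall e : R, 0 < e -> 0 < K e) ->
  (forall i : nat, (1 <= i <= m)%N -> has_approx_fixpoints K (S i)) ->
  has_approx_fixpoints (Psi n alpha K) (comp_upto n S).
Proof.
move=> n2m K0 fixS; case: n n2m => [|[|n]] //.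
have neS i : (1 <= i <= m)%N -> nonexpansive (comp_upto i S).
  move=> im.
  apply: displacement_bound_nonexpansive _ (comp_upto_displacement_bound i im).
  by rewrite ltW ?ratio_gt0 ?bigstar_le_itv.
elim: n => [|n IH] nm.
  have m1 : (1 <= 1 <= m)%N := ltnW nm.
  exact: approx_fixpoints_comp (alpha_itv 1%N m1) (alpha_itv 2%N nm) K0
    (neS 1%N m1) (avS 2%N nm) (fixS 1%N m1) (fixS 2%N nm).
have nm' : (1 <= n.+2 <= m)%N := ltnW nm.
(* The maximum of [Psi] and [K] serves as a common bound for the partial composition and for the
   next map. *)
apply: approx_fixpoints_comp.
- exact: bigstar_le_itv _ nm'.
- exact: alpha_itv n.+3 nm.
- by move=> e e0; rewrite lt_max K0 ?orbT.
- exact: neS n.+2 nm'.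
- exact: avS n.+3 nm.
- move=> e e0; have [p [pP pS]] := IH nm' e e0.
  by exists p; rewrite le_max pP.
- move=> e e0; have [q [qK qS]] := fixS n.+3 nm e e0.
  by exists q; rewrite le_max qK orbT.
Qed.

End AveragedFamily.

Theorem theorem2p8 (R : realType)
    (X : completeNormedModType R) (dot : {dot X for idfun})
    (dot_norm : forall x : X, dot x x = `|x| ^+ 2)
    (m : nat) (hm : (2 <= m)%N)
    (alpha : nat -> R)
    (halpha : forall i : nat, (1 <= i <= m)%N -> 0 < alpha i < 1)
    (S : nat -> X -> X)
    (hS : forall i : nat, (1 <= i <= m)%N -> averaged (alpha i) (S i))
    (K : R -> R) (hK : forall eps : R, 0 < eps -> 0 < K eps)
    (hKS : forall i : nat, (1 <= i <= m)%N -> forall eps : R, 0 < eps ->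
       exists p : X, `|p| <= K eps /\ `|p - S i p| <= eps)
    (b d : R) (hb : 0 < b) (hd : 0 < d)
    (x : X) (hxb : `|x| <= b) (hxd : `|x - comp_upto m S x| <= d) :
  rate_of_asymptotic_regularity (fun n => iter n (comp_upto m S) x)
    (comp_upto m S) (Sigma m alpha K b d).
Proof.
move=> eps e0; rewrite /Sigma /phi.
have m1 : (1 <= m <= m)%N by rewrite leqnn ltnW.
have m2 : (2 <= m <= m)%N by rewrite hm leqnn.
have e60 : 0 < eps / 6 by rewrite divr_gt0.
have [p [pP pS]] := comp_upto_approx_fixpoints dot dot_norm m alpha S halpha hS
  K m m2 hK hKS _ e60.
have P0 := Psi_gt0 m alpha K _ hm halpha hK e60.
have bT := comp_upto_displacement_bound dot dot_norm m alpha S halpha hS m m1.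
have := bigstar_le_itv m alpha halpha m m1.
move: (Psi _ _ _ _) (bigstar m alpha) P0 pP bT => P A P0 pP bT A_itv.
have kA := ratio_gt0 _ A_itv; have /andP[A0 A1] := A_itv.
set u := (_ / eps - 1); set w := d / _.
(* With this M, 18 b + 12 P = 6 M and 27 b + 18 P = 9 M. *)
pose M := 3 * b + 2 * P.
have M0 : 0 < M by rewrite /M; lra.
have uE : u = 6 * M / eps - 1 by rewrite /u /M; congr (_ / _ - 1); lra.
have Me : 0 < 6 * M / eps by rewrite divr_gt0 // mulr_gt0.
have omE : omega A d (eps ^+ 2 / (27 * b + 18 * P)) =
    (1 - A) / A / (4 * d) * (eps ^+ 2 / (9 * M)) ^+ 2.
  rewrite /omega; have -> : 27 * b + 18 * P = 9 * M by rewrite /M; lra.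
  by field; rewrite !gt_eqF.
have om0 : 0 < omega A d (eps ^+ 2 / (27 * b + 18 * P)).
  rewrite omE mulr_gt0 ?exprn_gt0 ?divr_gt0 ?mulr_gt0 //.
  by rewrite ?exprn_gt0 ?subr_gt0.
have w0 : 0 < w by rewrite divr_gt0.
(* u may be negative but exceeds -1, so its ceiling is still a natural number. *)
have N1ge0 : 0 <= Num.ceil u by rewrite ceil_ge0 uE; lra.
have N2gt0 : 0 < Num.ceil w by rewrite ceil_gt0.
(* The -1 inside the first ceiling yields N1 < 6 M / eps <= N1 + 1, the two bounds on the run length
   required by [displacement_bound_rate]. *)
have := ceil_itv u; have := ceil_itv w.
case: (Num.ceil u) N1ge0 => // N1 _; case: (Num.ceil w) N2gt0 => // N2 N20.
rewrite -PoszM => /andP[_ wN2] /andP[uN1 uN1'].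
split=> // n; rewrite lez_nat => leN.
have cancelE : eps * (6 * M / eps) = 6 * M by field; rewrite gt_eqF.
apply: (displacement_bound_rate _ ((1 - A) / A) eps b P d M x p N1 N2) => //.
- by rewrite /M; lra.
- rewrite -cancelE ler_pM2l // -natr1; move: uN1'; rewrite uE pmulrn; lra.
- rewrite -cancelE ler_pM2l //; move: uN1; rewrite uE intrB pmulrn; lra.
- by move: wN2; rewrite ler_pdivrMr // omE.
Qed.
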